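(* Let $A$ be a finite alphabet and $L\subseteq A^*$. The following are equivalent: (1) $L$ is context-free. (2) There exist a syntactic system of behavioural differential equations $(o,\delta): X \to \mathbb{B}\times\mathcal{T}(X)^A$ (with $X$ finite) and an $x\in X$ such that $[\![\bar{x}]\!]=L$, with respect to the extension $(\mathcal{T}(X),(\bar{o},\bar{\delta}))$. (3) There exist a syntactic system of behavioural differential equations $(o,\delta): X\to\mathbb{B}\times\mathcal{T}(X)^A$ (with $X$ finite) and a term $\tau\in\mathcal{T}(X)$ such that $[\![\tau]\!]=L$, with respect to the same extension.
   Context: For a finite set $X$ of nonterminals, $\mathcal{T}(X)$ is the set of purely syntactic terms $\tau ::= \bar{0} \mid \bar{1} \mid \bar{x}\ (x\in X) \mid \bar{a}\ (a\in A) \mid \tau+\tau \mid \tau\times\tau$. A syntactic system of behavioural differential equations is a map $(o,\delta):X\to\mathbb{B}\times\mathcal{T}(X)^A$ with $X$ finite, $\mathbb{B}=\{0,1\}$ the Boolean semiring; write $x_a:=\delta(x)(a)$. Let $j(0)=\bar 0$, $j(1)=\bar 1$. The extension $(\bar o,\bar\delta):\mathcal{T}(X)\to\mathbb{B}\times\mathcal{T}(X)^A$ (write $\tau_a:=\bar\delta(\tau)(a)$) is defined inductively: $\bar o(\bar x)=o(x)$, $\bar x_a=x_a$; $\bar o(\bar 0)=0$, $\bar 0_a=\bar 0$; $\bar o(\bar 1)=1$, $\bar 1_a=\bar 0$; $\bar o(\bar b)=0$, $\bar b_a=\bar 1$ if $b=a$ and $\bar 0$ otherwise; $\bar o(\sigma+\upsilon)=\bar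 o(\sigma)\vee\bar o(\upsilon)$, $(\sigma+\upsilon)_a=\sigma_a+\upsilon_a$; $\bar o(\sigma\times\upsilon)=\bar o(\sigma)\wedge\bar o(\upsilon)$, $(\sigma\times\upsilon)_a=(\sigma_a\times\upsilon)+(j(\bar o(\sigma))\times\upsilon_a)$. $[\![-]\!]:\mathcal{T}(X)\to\mathcal{P}(A^* )$ is the unique homomorphism into the final $\mathbb{B}\times(-)^A$-coalgebra of languages ($o(L)=1$ iff $\epsilon\in L$, $L_a=\{w\mid aw\in L\}$), i.e. $[\![\tau]\!]=\{w\mid \bar o(\tau_w)=1\}$ with word derivatives $\tau_\epsilon=\tau$, $\tau_{aw}=(\tau_a)_w$. A language is context-free if it is generated by a context-free grammar with finitely many nonterminals and productions. *)

(* Defs.v *)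
From Stdlib Require Import Relation_Operators.
From mathcomp Require Import all_boot boolp classical_sets.

Set Implicit Arguments.
Unset Strict Implicit.
Unset Printing Implicit Defensive.

Local Open Scope classical_set_scope.

Definition language (A : finType) := set (seq A).

(** * Context-free grammars *)

Definition symbol (N A : finType) : Type := (N + A)%type.

(* The production [(X, alpha)] stands for [X -> alpha]; [alpha] may be empty. *)
Record cfg (A : finType) := Cfg {
  nonterminal : finType;
  start : nonterminal;
  productions : seq (nonterminal * seq (symbol nonterminal A))
}.

Inductive cfg_step (A : finType) (G : cfg A) :
    seq (symbol (nonterminal G) A) -> seq (symbol (nonterminal G) A) -> Prop :=
| CfgStep u v X alpha :
    (X, alpha) \in productions G ->
    cfg_step (u ++ inl X :: v) (u ++ alpha ++ v).

Definition cfg_language (A : finType) (G : cfg A) : language A :=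
  [set w | clos_refl_trans _ (@cfg_step A G)
             [:: inl (start G)] [seq inr a | a <- w]].

Definition context_free (A : finType) (L : language A) : Prop :=
  exists G : cfg A, cfg_language G = L.

(** * Coalgebras for the functor [B x (-)^A] and the final semantics *)

Definition coalgebra (A : finType) (C : Type) : Type := C -> bool * (A -> C).

Definition word_deriv (A : finType) (C : Type) (d : coalgebra A C)
    (c : C) (w : seq A) : C :=
  foldl (fun c' a => (d c').2 a) c w.

Definition semantics (A : finType) (C : Type) (d : coalgebra A C) (c : C) :
    language A :=
  [set w | (d (word_deriv d c w)).1].

Definition language_coalgebra (A : finType) : coalgebra A (language A) :=
  fun L => (`[< L [::] >], fun a => [set w | L (a :: w)]).

Definition coalgebra_hom (A : finType) (C D : Type)
    (dC : coalgebra A C) (dD : coalgebra A D) (h : C -> D) : Prop :=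
  forall c, dD (h c) = ((dC c).1, fun a => h ((dC c).2 a)).

(* [semantics] is given by an explicit formula; the next two facts identify it
   with the unique homomorphism into the final coalgebra of languages. *)
Lemma semantics_hom (A : finType) (C : Type) (d : coalgebra A C) :
  coalgebra_hom d (@language_coalgebra A) (semantics d).
Proof.
by move=> c; rewrite /language_coalgebra; congr pair; exact: asboolb.
Qed.

Lemma semantics_unique (A : finType) (C : Type) (d : coalgebra A C)
    (h : C -> language A) :
  coalgebra_hom d (@language_coalgebra A) h -> h = semantics d.
Proof.
move=> hom; apply/funext => c; apply/funext => w; apply/propext.
elim: w c => [|a w IH] c.
  have [out_c _] := hom c; rewrite /semantics /= -out_c.
  by split => /asboolP.
have [_ /(congr1 (fun f => f a w)) /= ->] := hom c.
exact: IH.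
Qed.

(** * Terms and syntactic systems of behavioural differential equations *)

Inductive term (A X : finType) : Type :=
| TZero
| TOne
| TVar of X
| TLetter of A
| TAdd of term A X & term A X
| TMul of term A X & term A X.

Arguments TZero {A X}.
Arguments TOne {A X}.
Arguments TVar {A X}.
Arguments TLetter {A X}.

Definition bde_system (A X : finType) : Type := X -> bool * (A -> term A X).

Definition term_of_bool (A X : finType) (b : bool) : term A X :=
  if b then TOne else TZero.

Fixpoint term_out (A X : finType) (S : bde_system A X) (t : term A X) : bool :=
  match t with
  | TZero => false
  | TOne => true
  | TVar x => (S x).1
  | TLetter _ => false
  | TAdd s u => term_out S s || term_out S u
  | TMul s u => term_out S s && term_out S u
  end.

Fixpoint term_deriv (A X : finType) (S : bde_system A X) (t : term A X)
    (a : A) : term A X :=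
  match t with
  | TZero => TZero
  | TOne => TZero
  | TVar x => (S x).2 a
  | TLetter b => if b == a then TOne else TZero
  | TAdd s u => TAdd (term_deriv S s a) (term_deriv S u a)
  | TMul s u => TAdd (TMul (term_deriv S s a) u)
                     (TMul (term_of_bool A X (term_out S s)) (term_deriv S u a))
  end.

Definition extension (A X : finType) (S : bde_system A X) :
    coalgebra A (term A X) :=
  fun t => (term_out S t, term_deriv S t).

(* Main.v *)
(** A family of languages [I x] satisfying the equations of a system
    extends along the term operations to a coalgebra homomorphism, hence to the
    final semantics; both directions exhibit such a family.

    From a system to a grammar: distributing products over sums turns [t] and
    each [x_a] into a finite set of words over variables and letters. The
    productions are [x -> a v] for [v] in the set of [x_a], [x -> []] when [x]
    accepts the empty word, and a fresh start symbol producing the words of [t].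

    From a grammar to a system, instead of a normal form we use left corners. The
    first letter of a nonempty word derived from [X] sits at the end of a
    leftmost branch of the derivation tree, where siblings to the left of the
    branch derive the empty word. So [X_a] is the sum, over productions
    [Z -> alpha a beta] with [alpha] nullable, of [beta * [X, Z]], where the
    variable [[X, Z]] yields everything to the right of the branch from [X] down
    to [Z]. Reading a letter from [[X, Y]] means going up from [Y] through steps
    that yield the empty word, which is a finite reachability condition, and then
    taking one step [Z -> alpha Z' beta] with [beta] yielding a nonempty word;
    hence no left recursion or elimination of empty productions arises. *)

Require Import Defs.
From Stdlib Require Import Relation_Operators.
From mathcomp Require Import all_boot boolp classical_sets.

Set Implicit Arguments.
Unset Strict Implicit.
Unset Printing Implicit Defensive.

(** * Solutions of behavioural differential equations *)

Section Solutions.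
Variables (A X : finType).

Fixpoint term_lang (I : X -> language A) (t : term A X) (w : seq A) : Prop :=
  match t with
  | TZero => False
  | TOne => w = [::]
  | TVar x => I x w
  | TLetter a => w = [:: a]
  | TAdd s u => term_lang I s w \/ term_lang I u w
  | TMul s u => exists w1 w2,
      [/\ w = w1 ++ w2, term_lang I s w1 & term_lang I u w2]
  end.

Variables (S : bde_system A X) (I : X -> language A).
Hypothesis I_out : forall x, I x [::] <-> (S x).1.
Hypothesis I_deriv : forall x a w, I x (a :: w) <-> term_lang I ((S x).2 a) w.

Lemma term_lang_out t : term_lang I t [::] <-> term_out S t.
Proof.
elim: t => //= [s IHs u IHu|s IHs u IHu].
  by rewrite IHs IHu; split => /orP.
rewrite -(rwP andP) -IHs -IHu; split; last by move=> [? ?]; exists [::], [::].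
by move=> [[|? ?]] [[|? ?]] [].
Qed.

Lemma term_lang_deriv t a w :
  term_lang I t (a :: w) <-> term_lang I (term_deriv S t a) w.
Proof.
elim: t w => [||x|b|s IHs u IHu|s IHs u IHu] w //=.
- case: eqP => [->|ne] /=; first by split=> [[]|->].
  by split=> // -[/esym].
- by rewrite IHs IHu.
split.
  (* The letter is read from the right factor when the left one contributes the empty word; this is
     the summand guarded by [term_out S s]. *)
  move=> [[|b w1]] [w2] [/= eq_w sw1 uw2].
    right; exists [::], w; split => //; last by apply/IHu; rewrite eq_w.
    by move/term_lang_out: sw1 => ->.
  by case: eq_w sw1 => <- -> /IHs sw1; left; exists w1, w2.
case=> [[w1 [w2 [-> /IHs sw1 uw2]]]|[w1 [w2 [-> + /IHu uw2]]]].
  by exists (a :: w1), w2.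
case: (boolP (term_out S s)) => //= /term_lang_out s_nil ->.
by exists [::], (a :: w2).
Qed.

Lemma solution_semantics t : semantics (extension S) t = term_lang I t.
Proof.
rewrite -(@semantics_unique _ _ (extension S) (term_lang I)) // => {}t.
rewrite /language_coalgebra /extension /=; congr pair.
  by apply/idP/idP => [/asboolP/term_lang_out|/term_lang_out/asboolP].
by apply/funext => a; apply/funext => w; apply/propext/term_lang_deriv.
Qed.

Definition term_sum (T : Type) (f : T -> term A X) (r : seq T) : term A X :=
  foldr (fun i t => TAdd (f i) t) TZero r.

Lemma term_lang_sum (T : eqType) (f : T -> term A X) (r : seq T) w :
  term_lang I (term_sum f r) w <-> exists2 i, i \in r & term_lang I (f i) w.
Proof.
elim: r => [|i r IH] /=; first by split => // -[].
rewrite IH; split=> [[fi|[j jr fj]]|[j]].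
- by exists i; rewrite ?mem_head.
- by exists j; rewrite // inE jr orbT.
- by rewrite inE => /predU1P[->|jr] fj; [left|right; exists j].
Qed.

End Solutions.

(** * Derivation trees *)

Section Derivations.
Variables (A : finType) (G : cfg A).
Notation sym := (symbol (nonterminal G) A).

(** Forests of derivation trees replace rewriting sequences, so that induction sees the yield of
    each symbol separately, with no order of steps to track. *)
Inductive derives : seq sym -> seq A -> Prop :=
| DerivesNil : derives [::] [::]
| DerivesLetter a u w : derives u w -> derives (inr a :: u) (a :: w)
| DerivesVar X alpha u w1 w2 : (X, alpha) \in productions G ->
    derives alpha w1 -> derives u w2 -> derives (inl X :: u) (w1 ++ w2).

Lemma derives_nilE w : derives [::] w <-> w = [::].
Proof. by split=> [d|->]; [inversion d|constructor]. Qed.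

Lemma derives_letterE a u w :
  derives (inr a :: u) w <-> exists2 w', w = a :: w' & derives u w'.
Proof.
split=> [d|[w' -> ?]]; last by constructor.
by inversion d; subst; exists w0.
Qed.

Lemma derives_varE X u w : derives (inl X :: u) w <->
  exists alpha w1 w2, [/\ w = w1 ++ w2, (X, alpha) \in productions G,
                          derives alpha w1 & derives u w2].
Proof.
split=> [d|[alpha [w1 [w2 [-> Xa aw1 uw2]]]]]; last exact: DerivesVar Xa aw1 uw2.
by inversion d; subst; exists alpha, w1, w2.
Qed.

Lemma derives_cat u v w : derives (u ++ v) w <->
  exists w1 w2, [/\ w = w1 ++ w2, derives u w1 & derives v w2].
Proof.
split.
  elim: u w => [|[X|a] u IH] w /=.
  - by exists [::], w; split=> //; constructor.
  - move=> /derives_varE[alpha [w1 [w2 [-> Xa aw1 /IH[w3 [w4 [-> uw3 vw4]]]]]]].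
    by exists (w1 ++ w3), w4; rewrite catA; split=> //; apply: DerivesVar Xa aw1 uw3.
  - move=> /derives_letterE[_ -> /IH[w1 [w2 [-> uw1 vw2]]]].
    by exists (a :: w1), w2; split=> //; constructor.
move=> [w1 [w2 [{w}-> + vw2]]].
elim=> [|a u1 w _ IH|X alpha u1 w3 w4 Xa aw3 _ _ IH] /=; first by [].
  by constructor.
by rewrite -catA; apply: DerivesVar Xa aw3 IH.
Qed.

Lemma derives_letters w : derives [seq inr a | a <- w] w.
Proof. by elim: w => [|a w IH] /=; constructor. Qed.

Notation steps := (clos_refl_trans _ (@cfg_step A G)).

Lemma steps_context u v alpha beta :
  steps alpha beta -> steps (u ++ alpha ++ v) (u ++ beta ++ v).
Proof.
elim=> [_ _ [u' v' X gamma Xg]|?|? y ? _ IH1 _ IH2].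
- apply: rt_step.
  by have := CfgStep (u ++ u') (v' ++ v) Xg; rewrite -!catA.
- exact: rt_refl.
- exact: rt_trans IH1 IH2.
Qed.

Lemma cfg_languageE : cfg_language G = derives [:: inl (start G)].
Proof.
apply/funext => w; apply/propext; rewrite /cfg_language /=; split.
  (* The terminal word is its own forest; undoing a rewriting step gathers a segment of the forest
     under one nonterminal. *)
  suff sound u v : steps u v -> forall w, derives v w -> derives u w.
    by move=> /sound; apply; apply: derives_letters.
  elim=> [_ _ [u' v' X alpha Xa]|//|x y z _ IH1 _ IH2] w'.
    move=> /derives_cat[w1 [w2 [-> uw1 /derives_cat[w3 [w4 [-> aw3 vw4]]]]]].
    apply/derives_cat; exists w1, (w3 ++ w4); split=> //.
    exact: DerivesVar Xa aw3 vw4.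
  by move/IH2/IH1.
elim=> [|a u w' _ IH|X alpha u w1 w2 Xa _ IH1 _ IH2].
- exact: rt_refl.
- by have := steps_context [:: inr a] [::] IH; rewrite !cats0.
- apply: rt_trans (rt_step _ _ _ _ (CfgStep [::] u Xa)) _ => /=.
  apply: rt_trans (steps_context [::] u IH1) _ => /=.
  by have := steps_context [seq inr a | a <- w1] [::] IH2; rewrite !cats0 map_cat.
Qed.

End Derivations.

(** * From systems to grammars *)

Section GrammarOfSystem.
Variables (A X : finType) (S : bde_system A X).
Notation sym := (symbol (option X) A).

Fixpoint term_words (t : term A X) : seq (seq sym) :=
  match t with
  | TZero => [::]
  | TOne => [:: [::]]
  | TVar x => [:: [:: inl (Some x)]]
  | TLetter a => [:: [:: inr a]]
  | TAdd s u => term_words s ++ term_words u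
  | TMul s u => [seq v1 ++ v2 | v1 <- term_words s, v2 <- term_words u]
  end.

Definition system_productions (t : term A X) : seq (option X * seq sym) :=
  [seq (None, v) | v <- term_words t]
  ++ [seq (Some x, [::]) | x <- enum X & (S x).1]
  ++ [seq (Some p.1, inr p.2 :: v)
        | p <- enum {: X * A}, v <- term_words ((S p.1).2 p.2)].

Definition system_cfg (t : term A X) : cfg A :=
  Cfg None (system_productions t).

Lemma system_productions_start t v :
  ((None, v) \in system_productions t) = (v \in term_words t).
Proof.
rewrite !mem_cat mem_map; last by move=> ? ? [].
case: (v \in _) => //=; apply/negP => /orP[/mapP[? _ []]|/allpairsPdep].
  by [].
by move=> [? [? []]].
Qed.

Lemma system_productions_var t x v :
  (Some x, v) \in system_productions t <->
  (v = [::] /\ (S x).1) \/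
  exists a v', v = inr a :: v' /\ v' \in term_words ((S x).2 a).
Proof.
rewrite !mem_cat; split.
  case/or3P=> [/mapP[? _ []]//|/mapP[y + [-> ->]]|/allpairsPdep[[y a] [v' [_ /= + [-> ->]]]]].
    by rewrite mem_filter => /andP[]; left.
  by right; exists a, v'.
case=> [[-> Sx]|[a [v' [-> v'P]]]].
  by apply/or3P/Or32/mapP; exists x; rewrite // mem_filter Sx mem_enum.
by apply/or3P/Or33/allpairsPdep; exists (x, a), v'; rewrite mem_enum.
Qed.

(** Concatenation of languages distributes over union. The grammar is fixed by [t0] while [t]
    varies, so that the lemma also covers the right-hand sides of the system. *)
Lemma derives_term_words t0 t w :
  (exists2 v, v \in term_words t & @derives A (system_cfg t0) v w) <->
  term_lang (fun x => @derives A (system_cfg t0) [:: inl (Some x)]) t w.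
Proof.
elim: t w => [||x|a|s IHs u IHu|s IHs u IHu] w /=.
- by split=> // -[].
- split=> [[v /[!inE]/eqP-> /derives_nilE]|->] //.
  by exists [::] => //; constructor.
- by split=> [[v /[!inE]/eqP->]|d] //; exists [:: inl (Some x)] => //; rewrite inE.
- split=> [[v /[!inE]/eqP-> /derives_letterE[w' -> /derives_nilE->]]|->] //.
  by exists [:: inr a]; [rewrite inE|repeat constructor].
- rewrite -IHs -IHu; split=> [[v + vw]|[[v vs vw]|[v vu vw]]].
  + by rewrite mem_cat => /orP[]; [left|right]; exists v.
  + by exists v; rewrite // mem_cat vs.
  + by exists v; rewrite // mem_cat vu orbT.
- split=> [[_ /allpairsP[[v1 v2] [/= v1s v2u ->]]]|].
    move=> /derives_cat[w1 [w2 [-> vw1 vw2]]].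
    by exists w1, w2; split; [|apply/IHs; exists v1|apply/IHu; exists v2].
  move=> [w1 [w2 [-> /IHs[v1 v1s vw1] /IHu[v2 v2u vw2]]]].
  exists (v1 ++ v2); first by apply/allpairsP; exists (v1, v2).
  by apply/derives_cat; exists w1, w2.
Qed.

Lemma context_free_semantics t : context_free (semantics (extension S) t).
Proof.
exists (system_cfg t); pose I x := @derives A (system_cfg t) [:: inl (Some x)].
(* Productions of [Some x] are empty or start with a letter, so one unfolding gives both the output
   and the derivative equation for [I]. *)
have varE x w : I x w <-> (w = [::] /\ (S x).1) \/
    exists a w', w = a :: w' /\ term_lang I ((S x).2 a) w'.
  split.
    move=> /derives_varE[v [w1 [w2 [-> + vw1 /derives_nilE->]]]].
    rewrite cats0 => /system_productions_var[[v0 Sx]|[a [v' [v0 v'P]]]].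
      by left; split=> //; apply/(derives_nilE (system_cfg t)); rewrite -v0.
    right; move: vw1; rewrite v0 => /derives_letterE[w' -> v'w'].
    by exists a, w'; split=> //; apply/derives_term_words; exists v'.
  move=> wP; apply/derives_varE; case: wP => [[-> Sx]|[a [w' [-> ]]]].
    exists [::], [::], [::]; split=> //; try by constructor.
    by apply/system_productions_var; left.
  move=> /derives_term_words[v vP vw'].
  exists (inr a :: v), (a :: w'), [::]; split; rewrite ?cats0 //; try by constructor.
  by apply/system_productions_var; right; exists a, v.
rewrite (@solution_semantics _ _ S I).
- rewrite cfg_languageE; apply/funext => w; apply/propext.
  rewrite -derives_term_words derives_varE; split.
    move=> [v [w1 [w2 [-> + vw1 /derives_nilE->]]]].
    by rewrite cats0 [_ \in _]system_productions_start; exists v.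
  move=> [v vP vw]; exists v, w, [::].
  split; rewrite ?cats0 //; last by constructor.
  by rewrite [_ \in _]system_productions_start.
- move=> x; rewrite varE; split=> [[[]//|[a [w' []]]//]|]; by left.
- move=> x a w; rewrite varE; split=> [[[]//|[_ [_ [[<- <-]]]]//]|tw].
  by right; exists a, w.
Qed.

End GrammarOfSystem.

(** * From grammars to systems *)

Section SystemOfGrammar.
Variables (A : finType) (G : cfg A).
Notation N := (nonterminal G).
Notation sym := (symbol N A).
Notation derives := (@derives A G).

(** * Left corners and spines *)

Fixpoint heads (u : seq sym) : seq (sym * seq sym) :=
  if u is s :: v then (s, v) :: (if `[< derives [:: s] [::] >] then heads v else [::])
  else [::].

(** The possible single steps down a leftmost branch, with what remains to the right. *)
Definition left_corners : seq (N * (sym * seq sym)) :=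
  [seq (p.1, h) | p <- productions G, h <- heads p.2].

(* [spine X Y w]: some derivation from [X] has a leftmost branch (up to
   nullable siblings) ending in [Y], and [w] is what it yields right of [Y]. *)
Inductive spine (X : N) : N -> seq A -> Prop :=
| SpineRefl : spine X X [::]
| SpineStep Y Z u w1 w2 : (Z, (inl Y, u)) \in left_corners ->
    derives u w1 -> spine X Z w2 -> spine X Y (w1 ++ w2).

(** Branches are joined end to end; the lower one lies further left, so its yield comes first. *)
Lemma spine_trans X Y Z w1 w2 :
  spine X Y w2 -> spine Y Z w1 -> spine X Z (w1 ++ w2).
Proof.
move=> XY; elim=> [|Z' Z'' u w3 w4 lc uw3 _ IH] //.
by rewrite -catA; exact: SpineStep lc uw3 IH.
Qed.

Lemma heads_derives s v u w :
  (s, v) \in heads u -> derives (s :: v) w -> derives u w.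
Proof.
elim: u => [|s' u IH] //=; rewrite inE => /predU1P[[-> ->]//|].
case: asboolP => // s'_nil /IH{}IH /IH uw.
by rewrite -cat1s; apply/derives_cat; exists [::], w.
Qed.

Lemma left_corner_derives Z s v w :
  (Z, (s, v)) \in left_corners -> derives (s :: v) w -> derives [:: inl Z] w.
Proof.
move=> /allpairsPdep[[Z' u] [h [/= Zu + [-> eh]]]].
rewrite -{h}eh => /heads_derives hu /hu uw.
by rewrite -[w]cats0; apply: DerivesVar Zu uw (DerivesNil _).
Qed.

Lemma spine_derives X Y w w' :
  spine X Y w' -> derives [:: inl Y] w -> derives [:: inl X] (w ++ w').
Proof.
move=> XY; elim: XY w => [w|Y' Z u w1 w2 lc uw1 _ IH w Yw]; first by rewrite cats0.
rewrite catA; apply: IH; apply: left_corner_derives lc _.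
by rewrite -cat1s; apply/derives_cat; exists w, w1.
Qed.

(** * Removing the first letter of a yield *)

Definition var_deriv X a w := exists Z u w1 w2,
  [/\ (Z, (inr a, u)) \in left_corners, w = w1 ++ w2, derives u w1 & spine X Z w2].

Definition sym_deriv (s : sym) a w :=
  match s with inl X => var_deriv X a w | inr b => b = a /\ w = [::] end.

Definition form_deriv u a w := exists s v w1 w2,
  [/\ (s, v) \in heads u, w = w1 ++ w2, sym_deriv s a w1 & derives v w2].

Lemma var_deriv_of_word X u a w :
  (X, u) \in productions G -> form_deriv u a w -> var_deriv X a w.
Proof.
move=> Xu [s [v [w1 [w2 [hu -> sw1 vw2]]]]].
have lc : (X, (s, v)) \in left_corners.
  by apply/allpairsPdep; exists (X, u), (s, v).
case: s sw1 lc {hu} => [Y|b] /=.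
  move=> [Z [u' [w3 [w4 [lc' -> uw3 YZ]]]]] lc.
  exists Z, u', w3, (w4 ++ w2); rewrite catA; split=> //.
  apply: spine_trans YZ; rewrite -[w2]cats0.
  exact: SpineStep lc vw2 (SpineRefl _).
move=> [-> ->] lc; exists X, v, w2, [::]; rewrite cats0; split=> //.
exact: SpineRefl.
Qed.

Lemma derives_consE u a w : derives u (a :: w) <-> form_deriv u a w.
Proof.
split.
  move eqw : (a :: w) => w0 d.
  elim: d a w eqw => [|b v w' vw' _|X al v w1 w2 Xa aw1 IH1 vw2 IH2] a w //.
    by move=> [-> ->]; exists (inr b), v, [::], w'; split=> //; rewrite mem_head.
  (* If [X] yields the empty word, it is nullable and [heads] skips it; otherwise the first letter
     comes from [X], which is then the head. *)
  case: w1 aw1 IH1 => [|b w1] aw1 IH1 /=.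
    move=> /IH2[s [v' [w3 [w4 [hv -> sw3 vw4]]]]].
    exists s, v', w3, w4; split=> //=; rewrite inE; case: asboolP.
      by rewrite hv orbT.
    by case; exact: (DerivesVar Xa aw1 (DerivesNil _)).
  move=> [-> ->]; exists (inl X), v, w1, w2; split=> //; first exact: mem_head.
  exact: var_deriv_of_word Xa (IH1 _ _ _).
move=> [s [v [w1 [w2 [hu -> sw1 vw2]]]]]; apply: heads_derives hu _.
case: s sw1 => [X|b] /=; last by move=> [-> ->]; constructor.
move=> [Z [u' [w3 [w4 [lc -> uw3 XZ]]]]].
rewrite -cat1s; apply/derives_cat; exists (a :: w3 ++ w4), w2; split=> //.
apply: (spine_derives (w := a :: w3)) XZ _.
by apply: left_corner_derives lc _; constructor.
Qed.

Lemma derives_var_consE X a w : derives [:: inl X] (a :: w) <-> var_deriv X a w.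
Proof.
rewrite derives_consE; split.
  move=> [s [v [w1 [w2 [/= + -> sw1]]]]]; rewrite inE.
  rewrite (_ : (if _ then _ else _) = [::]) ?if_same // orbF => /eqP[es ->].
  by move/derives_nilE->; rewrite cats0; move: sw1; rewrite es.
move=> Xw; exists (inl X), [::], w, [::]; rewrite cats0 mem_head.
by split=> //; constructor.
Qed.

Lemma spine_consE X Y a w : spine X Y (a :: w) <->
  exists Z Z' u w1 w2, [/\ (Z, (inl Z', u)) \in left_corners, w = w1 ++ w2,
    spine Z' Y [::], derives u (a :: w1) & spine X Z w2].
Proof.
split.
  move eqw : (a :: w) => w0 d.
  elim: d a w eqw => [|Y' Z u w1 w2 lc uw1 XZ IH] a w //.
  (* The climb starts at the bottom of the branch: a step with empty yield joins the empty spine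
     below, and the first one with nonempty yield supplies the letter. *)
  case: w1 uw1 => [|b w1] uw1 /=.
    move=> /IH[Z1 [Z2 [u' [w3 [w4 [lc' -> ZZ uw3 XZ1]]]]]].
    exists Z1, Z2, u', w3, w4; split=> //.
    exact: SpineStep lc uw1 ZZ.
  move=> [-> ->]; exists Z, Y', u, w1, w2; split=> //; exact: SpineRefl.
move=> [Z [Z' [u [w1 [w2 [lc -> Z'Y uw1 XZ]]]]]].
exact: spine_trans (SpineStep lc uw1 XZ) Z'Y.
Qed.

(** * The system of a grammar and its solution *)

(* The variable [inr (X, Y)] stands for the language [spine X Y]. *)
Notation V := (N + N * N)%type.

Definition form_term (u : seq sym) : term A V :=
  foldr (fun s t => TMul (match s with inl X => TVar (inl X) | inr a => TLetter a end) t)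
        TOne u.

Definition var_deriv_term (a : A) (X : N) : term A V :=
  term_sum (fun c => TMul (form_term c.2.2) (TVar (inr (X, c.1))))
    [seq c <- left_corners | c.2.1 == inr a].

Definition sym_deriv_term (a : A) (s : sym) : term A V :=
  match s with
  | inl X => var_deriv_term a X
  | inr b => if b == a then TOne else TZero
  end.

(** Terms have no derivative operator, so the derivative of a sentential form is unfolded into its
    heads; the nullability tests are constants of the grammar. *)
Definition form_deriv_term (a : A) (u : seq sym) : term A V :=
  term_sum (fun h => TMul (sym_deriv_term a h.1) (form_term h.2)) (heads u).

Definition spine_deriv_term (a : A) (X Y : N) : term A V :=
  term_sum (fun c => TMul (form_deriv_term a c.2.2) (TVar (inr (X, c.1))))
    [seq c <- left_corners
       | if c.2.1 is inl Z then `[< spine Z Y [::] >] else false].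

Definition cfg_system : bde_system A V := fun x =>
  match x with
  | inl X => (`[< derives [:: inl X] [::] >], var_deriv_term^~ X)
  | inr (X, Y) => (`[< spine X Y [::] >], fun a => spine_deriv_term a X Y)
  end.

Definition cfg_solution (x : V) : language A :=
  match x with inl X => derives [:: inl X] | inr (X, Y) => spine X Y end.

Notation tlang := (term_lang cfg_solution).

Lemma form_termE u w : tlang (form_term u) w <-> derives u w.
Proof.
elim: u w => [|s u IH] w /=; first by rewrite derives_nilE.
rewrite -cat1s derives_cat.
split=> -[w1 [w2 [-> sw1 /IH uw2]]]; exists w1, w2; split=> //.
  by case: s sw1 => [X|a] //= ->; repeat constructor.
by case: s sw1 => [X|a] //= /derives_letterE[w' -> /derives_nilE->].
Qed.

Lemma var_deriv_termE a X w : tlang (var_deriv_term a X) w <-> var_deriv X a w.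
Proof.
rewrite term_lang_sum; split.
  move=> [[Z [s u]]]; rewrite mem_filter /= => /andP[/eqP-> lc].
  by move=> [w1 [w2 [-> /form_termE uw1 XZ]]]; exists Z, u, w1, w2.
move=> [Z [u [w1 [w2 [lc -> /form_termE uw1 XZ]]]]].
by exists (Z, (inr a, u)); [rewrite mem_filter eqxx|exists w1, w2].
Qed.

Lemma sym_deriv_termE a s w : tlang (sym_deriv_term a s) w <-> sym_deriv s a w.
Proof.
case: s => [X|b] /=; first exact: var_deriv_termE.
by case: eqP => /= [->|ne]; split=> // -[].
Qed.

Lemma form_deriv_termE a u w : tlang (form_deriv_term a u) w <-> derives u (a :: w).
Proof.
rewrite derives_consE term_lang_sum; split.
  move=> [[s v] hu [w1 [w2 [-> /sym_deriv_termE sw1 /form_termE vw2]]]].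
  by exists s, v, w1, w2.
move=> [s [v [w1 [w2 [hu -> /sym_deriv_termE sw1 /form_termE vw2]]]]].
by exists (s, v) => //; exists w1, w2.
Qed.

Lemma spine_deriv_termE a X Y w :
  tlang (spine_deriv_term a X Y) w <-> spine X Y (a :: w).
Proof.
rewrite spine_consE term_lang_sum; split.
  move=> [[Z [[Z'|b] u]]]; rewrite mem_filter //= => /andP[/asboolP ZY lc].
  move=> [w1 [w2 [-> /form_deriv_termE uw1 XZ]]].
  by exists Z, Z', u, w1, w2.
move=> [Z [Z' [u [w1 [w2 [lc -> ZY /form_deriv_termE uw1 XZ]]]]]].
exists (Z, (inl Z', u)); last by exists w1, w2.
by rewrite mem_filter lc andbT; apply/asboolP.
Qed.

Lemma cfg_system_semantics :
  semantics (extension cfg_system) (TVar (inl (start G))) = cfg_language G.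
Proof.
rewrite cfg_languageE (@solution_semantics _ _ _ cfg_solution) //.
  by move=> [X|[X Y]]; split=> /asboolP.
move=> [X|[X Y]] a w /=; first by rewrite var_deriv_termE derives_var_consE.
by rewrite spine_deriv_termE.
Qed.

End SystemOfGrammar.

Theorem theorem4p4 (A : finType) (L : language A) :
  [<-> context_free L;
       exists (X : finType) (S : bde_system A X) (x : X),
         semantics (extension S) (TVar x) = L;
       exists (X : finType) (S : bde_system A X) (t : term A X),
         semantics (extension S) t = L].
Proof.
tfae.
- by move=> [G <-]; do 3 eexists; apply: cfg_system_semantics.
- by move=> [X [S [x <-]]]; exists X, S, (TVar x).
- by move=> [X [S [t <-]]]; apply: context_free_semantics.
Qed.
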